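(* If $n\ge 3$, then $$\mathrm{mob}(C_n\,\square\, K_2)=\begin{cases}3, & n=3,\\ 2, & n=4,\\ 4, & n\ge 5.\end{cases}$$
   Context: $C_n$ is the cycle on $n$ vertices; $\square$ is the Cartesian product (so $C_n\,\square\,K_2$ is the prism over $C_n$). A set $S\subseteq V(G)$ is a general position set if no three vertices of $S$ lie on a common shortest path. Robots are placed one per vertex of a general position set $S$; a move $u\to v$ along an edge $uv$ with $u\in S$ is legal if $v\notin S$ and $(S\setminus\{u\})\cup\{v\}$ is a general position set. $S$ is a mobile general position set if some sequence of legal moves starting from $S$ visits every vertex at least once; $\mathrm{mob}(G)$ is the maximum size of a mobile general position set. *)

(* Defs.v *)
From mathcomp Require Import all_boot.
From mathcomp Require Import boolp.

Set Implicit Arguments.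
Unset Strict Implicit.
Unset Printing Implicit Defensive.

(* A finite simple graph is a symmetric irreflexive [e : rel T] on a
   [T : finType]. *)

Section Graphs.

(* [ordS i] is [i + 1] modulo [n], so this is the cycle on [n] vertices for
   [n >= 3]; for [n = 1] it would be a loop, for [n = 2] a single edge. *)
Definition cycle_graph (n : nat) : rel 'I_n :=
  fun i j => (j == ordS i) || (i == ordS j).

Definition complete_graph (n : nat) : rel 'I_n := fun i j => i != j.

Definition cartesian_product (T U : finType) (e : rel T) (f : rel U) :
    rel (T * U) :=
  fun x y => ((x.1 == y.1) && f x.2 y.2) || (e x.1 y.1 && (x.2 == y.2)).

Lemma cycle_graph_sym n : symmetric (@cycle_graph n).
Proof. by move=> i j; rewrite /cycle_graph orbC. Qed.

Lemma cycle_graph_irr n : 2 < n -> irreflexive (@cycle_graph n).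
Proof.
move=> n_gt2 i; rewrite /cycle_graph orbb; apply/eqP => /(congr1 val) /=.
have := ltn_ord i; rewrite leq_eqVlt => /orP [/eqP iE|lt_in].
  by rewrite iE modnn => i0; move: n_gt2; rewrite -iE i0.
by rewrite modn_small // => /eqP; rewrite -addn1 -{1}(addn0 i) eqn_add2l.
Qed.

Lemma complete_graph_sym n : symmetric (@complete_graph n).
Proof. by move=> i j; rewrite /complete_graph eq_sym. Qed.

Lemma complete_graph_irr n : irreflexive (@complete_graph n).
Proof. by move=> i; rewrite /complete_graph eqxx. Qed.

Lemma cartesian_product_sym (T U : finType) (e : rel T) (f : rel U) :
  symmetric e -> symmetric f -> symmetric (cartesian_product e f).
Proof.
move=> es fs x y; rewrite /cartesian_product es fs.
by rewrite (eq_sym x.1) (eq_sym x.2).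
Qed.

Lemma cartesian_product_irr (T U : finType) (e : rel T) (f : rel U) :
  irreflexive e -> irreflexive f -> irreflexive (cartesian_product e f).
Proof. by move=> ei fi x; rewrite /cartesian_product ei fi andbF. Qed.

End Graphs.

Section MobilePosition.

Variables (T : finType) (e : rel T).

(* The walk with vertex sequence [x :: p] has [size p] edges. *)
Definition shortest_path (x : T) (p : seq T) : Prop :=
  path e x p /\
  forall q : seq T, path e x q -> last x q = last x p -> size p <= size q.

Definition general_position (S : {set T}) : Prop :=
  forall (x : T) (p : seq T) (u v w : T),
    shortest_path x p ->
    u \in S -> v \in S -> w \in S -> uniq [:: u; v; w] ->
    ~ [/\ u \in x :: p, v \in x :: p & w \in x :: p].

Definition legal_move (S S' : {set T}) : Prop :=
  exists u v : T,
    [/\ u \in S, e u v, v \notin S, S' = v |: (S :\ u)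
      & general_position S'].

(* [S :: s] is the sequence of successive configurations; a vertex is visited
   when it is occupied in one of them, the initial one included. *)
Definition mobile (S : {set T}) : Prop :=
  general_position S /\
  exists s : seq {set T},
    path (fun A B => `[< legal_move A B >]) S s /\
    forall v : T, exists2 A : {set T}, A \in S :: s & v \in A.

(* The empty maximum is 0; it does not occur for a connected nonempty graph,
   where every singleton is mobile. *)
Definition mob : nat := \max_(S : {set T} | `[< mobile S >]) #|S|.

End MobilePosition.

(* Main.v *)
(**
  The distance in the prism is the arc distance of the columns plus the
  difference of the layers, and a set is in general position iff no three of
  its vertices make the triangle inequality tight.

  Upper bounds.  Three vertices of one layer in general position cut the cycle
  into arcs shorter than [n / 2].  The column [w] of a fourth vertex lies in
  one of these arcs, and one of the two routes from [w] to the vertex opposite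
  to that arc has length at most [n / 2] and passes through an end of the arc;
  hence [|S| <= 4].  If [|S| >= 3], two vertices of [S] cannot share a column,
  which gives [|S| <= 3] for [n = 3].  For [n = 4] the prism is the 3-cube,
  where triples in general position have all distances 2; a move changes the
  bipartition class of the moved robot, so it is never legal when [|S| >= 3].

  Lower bounds.  Four robots on alternating layers whose consecutive gaps
  around the cycle are all shorter than [n / 2] are in general position, and
  for [n >= 5] they can be advanced one at a time.  For [n = 3] one robot per
  column suffices, and for [n = 4] a pair of robots rotates freely.
*)

Require Import Defs.
From mathcomp Require Import all_boot.
From mathcomp Require Import boolp zify.

Set Implicit Arguments.
Unset Strict Implicit.
Unset Printing Implicit Defensive.

(** * Shortest paths and general position in terms of a distance function *)

Section GraphDistance.

Variables (T : finType) (e : rel T) (d : T -> T -> nat).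

(* Local conditions that force [d] to be the shortest-path distance of [e]. *)
Hypothesis dxx : forall x, d x x = 0.
Hypothesis d_lipschitz : forall x y z, e x y -> d x z <= (d y z).+1.
Hypothesis d_eq0 : forall x y, d x y = 0 -> x = y.
Hypothesis d_descent :
  forall x y k, d x y = k.+1 -> exists2 z, e x z & d z y = k.

Lemma dist_le_walk x p : path e x p -> d x (last x p) <= size p.
Proof.
elim: p x => [|y p IH] x /=; first by rewrite dxx.
by case/andP=> exy /IH; have := d_lipschitz (last y p) exy; lia.
Qed.

Lemma geodesic_exists x y :
  exists p, [/\ path e x p, last x p = y & size p = d x y].
Proof.
move: {2}(d x y) (erefl (d x y)) => k; elim: k x => [|k IH] x dk.
  by exists [::]; rewrite dk; split=> //; apply: d_eq0.
have [z exz dz] := d_descent dk; have [p [pp lp sp]] := IH _ dz.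
by exists (z :: p) => /=; rewrite exz pp lp sp dz dk.
Qed.

Lemma dist_triangle x y z : d x z <= d x y + d y z.
Proof.
have [p [pp lp <-]] := geodesic_exists x y.
have [q [pq lq <-]] := geodesic_exists y z.
rewrite -size_cat; have := @dist_le_walk x (p ++ q).
by rewrite last_cat lp lq cat_path pp lp pq; apply.
Qed.

Lemma shortest_path_size x p : shortest_path e x p -> size p = d x (last x p).
Proof.
case=> pp ps; apply/eqP; rewrite eqn_leq dist_le_walk // andbT.
by have [q [pq lq <-]] := geodesic_exists x (last x p); apply: ps.
Qed.

(** The stretches up to [y], from [y] to [z] and after [z] bound the distances of their ends, and
    their lengths add up to that of the path, itself a distance; the triangle inequality leaves no
    slack. *)
Lemma shortest_path_between x p y z (s := x :: p) :
  shortest_path e x p -> y \in s -> z \in s -> index y s <= index z s ->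
  d y z = index z s - index y s.
Proof.
move=> sp yin zin; set i := index y s; set j := index z s => leij.
have pp : path e x p by case: sp.
have dist_nth a b : a <= b -> b <= size p -> d (nth x s a) (nth x s b) <= b - a.
  elim: b => [|b IH] ab bp.
    by rewrite leqn0 in ab; rewrite (eqP ab) dxx.
  move: ab; rewrite leq_eqVlt => /predU1P[->|ab]; first by rewrite dxx.
  have eb : e (nth x s b) (nth x s b.+1) by apply: (pathP x pp).
  have := IH ab (ltnW bp).
  have := dist_triangle (nth x s a) (nth x s b) (nth x s b.+1).
  by have := d_lipschitz (nth x s b.+1) eb; rewrite dxx; lia.
have js : j <= size p by rewrite -ltnS -[(size p).+1]/(size s) index_mem.
have dxy : d x y <= i.
  by have := dist_nth 0 i isT (leq_trans leij js); rewrite subn0 nth_index.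
have dyz : d y z <= j - i by have := dist_nth i j leij js; rewrite !nth_index.
have dzl : d z (last x p) <= size p - j.
  by have := dist_nth j (size p) js (leqnn _); rewrite nth_last nth_index.
have := shortest_path_size sp; have := dist_triangle x y (last x p).
by have := dist_triangle y z (last x p); lia.
Qed.

(** A tight triangle inequality turns two concatenated geodesics into a shortest path; conversely,
    distances along a shortest path are index differences, which add up. *)
Lemma general_positionP (S : {set T}) :
  general_position e S <->
  (forall u v w, u \in S -> v \in S -> w \in S -> uniq [:: u; v; w] ->
    d u v + d v w != d u w).
Proof.
split=> [gpS u v w uS vS wS uvw|ncS x p u v w sp uS vS wS uvw [ui vi wi]].
  apply/eqP=> duw; have [p [pp lp sp]] := geodesic_exists u v.
  have [q [pq lq sq]] := geodesic_exists v w.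
  have luw : last u (p ++ q) = w by rewrite last_cat lp.
  apply: (gpS u (p ++ q) u v w) => //.
    split=> [|r pr]; first by rewrite cat_path pp lp.
    rewrite luw size_cat sp sq duw => <-; exact: dist_le_walk.
  split; first exact: mem_head.
    by rewrite -cat_cons mem_cat -{1}lp mem_last.
  by rewrite -luw mem_last.
wlog : u v w uS vS wS uvw ui vi wi /
    index u (x :: p) <= index v (x :: p) <= index w (x :: p) => [WH|/andP[uv vw]].
  have P1 := WH u v w uS vS wS uvw ui vi wi.
  move: uvw; rewrite /= !inE !negb_or andbT -!andbA => /and3P[uv uw vw].
  have P2 := WH u w v uS wS vS _ ui wi vi.
  have P3 := WH v u w vS uS wS _ vi ui wi.
  have P4 := WH v w u vS wS uS _ vi wi ui.
  have P5 := WH w u v wS uS vS _ wi ui vi.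
  have P6 := WH w v u wS vS uS _ wi vi ui.
  move: P1 P2 P3 P4 P5 P6; rewrite /= !inE !negb_or.
  rewrite ![v == u]eq_sym ![w == u]eq_sym ![w == v]eq_sym uv uw vw /=.
  by move=> P1 /(_ isT) P2 /(_ isT) P3 /(_ isT) P4 /(_ isT) P5 /(_ isT) P6; lia.
have := ncS u v w uS vS wS uvw; have uw := leq_trans uv vw.
rewrite (shortest_path_between sp ui vi uv) (shortest_path_between sp vi wi vw).
by rewrite (shortest_path_between sp ui wi uw); lia.
Qed.

End GraphDistance.

(** * Distance in the prism *)

Definition prism n : rel ('I_n * 'I_2) :=
  cartesian_product (@cycle_graph n) (@complete_graph 2).

(** Since subtraction is truncated, [(i - j) + (j - i)] is |i - j|. *)
Definition cycle_dist n (i j : nat) : nat :=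
  minn ((i - j) + (j - i)) (n - ((i - j) + (j - i))).

Lemma cycle_distC n i j : cycle_dist n i j = cycle_dist n j i.
Proof. by rewrite /cycle_dist addnC. Qed.

Lemma cycle_distE n i j : i <= j ->
  cycle_dist n i j = if (j - i).*2 <= n then j - i else n - (j - i).
Proof. by rewrite /cycle_dist => ij; case: ifP; lia. Qed.

(** The step follows a shorter arc towards [j], crossing between [n - 1] and [0] when needed. *)
Lemma cycle_dist_descent n i j k : i < n -> j < n -> cycle_dist n i j = k.+1 ->
  exists m, [/\ m < n, cycle_dist n m j = k &
    [|| i.+1 == m, m.+1 == i, (i.+1 == n) && (m == 0)
      | (m.+1 == n) && (i == 0)]].
Proof.
move=> hi hj; have [ij|ji|->] := ltngtP i j; last by rewrite /cycle_dist; lia.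
  rewrite cycle_distE ?(ltnW ij) //; case: ifP => h dk.
    by exists i.+1; rewrite cycle_distE //; split; [lia|case: ifP; lia|lia].
  case: i ij hi h dk => [|i] ij hi h dk.
    exists n.-1; rewrite cycle_distC cycle_distE; last by lia.
    by split; [lia|case: ifP; lia|lia].
  by exists i; rewrite cycle_distE; [split; [lia|case: ifP; lia|lia]|lia].
rewrite cycle_distC cycle_distE ?(ltnW ji) //; case: ifP => h dk.
  exists i.-1; rewrite cycle_distC cycle_distE; last by lia.
  by split; [lia|case: ifP; lia|lia].
have [ni|ni] := eqVneq i.+1 n.
  by exists 0; rewrite cycle_distE //; split; [lia|case: ifP; lia|lia].
exists i.+1; rewrite cycle_distC cycle_distE; last by lia.
by split; [lia|case: ifP; lia|lia].
Qed.

(** * Betweenness on the cycle *)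

Definition cycle_between n i j k :=
  cycle_dist n i j + cycle_dist n j k == cycle_dist n i k.

Lemma cycle_betweenC n i j k : cycle_between n i j k = cycle_between n k j i.
Proof.
rewrite /cycle_between addnC [cycle_dist n i j]cycle_distC.
by rewrite [cycle_dist n j k]cycle_distC [cycle_dist n i k]cycle_distC.
Qed.

Lemma cycle_between_direct n i j k :
  i <= j <= k -> (k - i).*2 <= n -> cycle_between n i j k.
Proof.
by move=> /andP[ij jk] h; rewrite /cycle_between !cycle_distE; do ?case: ifP; lia.
Qed.

Lemma cycle_between_wrapl n i j k :
  i <= j <= k -> k < n -> n <= (k - j).*2 -> cycle_between n k i j.
Proof.
move=> /andP[ij jk] kn h; rewrite /cycle_between.
rewrite (cycle_distC n k i) (cycle_distC n k j).
by rewrite !cycle_distE; do ?case: ifP; lia.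
Qed.

Lemma cycle_between_wrapr n i j k :
  i <= j <= k -> k < n -> n <= (j - i).*2 -> cycle_between n j k i.
Proof.
move=> /andP[ij jk] kn h; rewrite /cycle_between.
rewrite (cycle_distC n k i) (cycle_distC n j i).
by rewrite !cycle_distE; do ?case: ifP; lia.
Qed.

Lemma cycle_between_cover_sorted n a b c w : a < b < c -> c < n -> w < n ->
  ~~ cycle_between n a b c -> ~~ cycle_between n b a c ->
  ~~ cycle_between n a c b ->
  [|| cycle_between n a b w, cycle_between n a c w, cycle_between n b a w,
      cycle_between n b c w, cycle_between n c a w | cycle_between n c b w].
Proof.
move=> /andP[ab bc] cn wn; have ac := ltn_trans ab bc.
move=> n1 n2 n3.
(* The three failures say that each arc cut out by [a], [b], [c] is shorter than half the cycle. *)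
have {n1 n2 n3} [g1 g2 g3] : [/\ (b - a).*2 < n, (c - b).*2 < n & n < (c - a).*2].
  move: n1 n2 n3; rewrite /cycle_between.
  rewrite (cycle_distC n b a) (cycle_distC n c b) !cycle_distE //; try lia.
  by do !case: ifP => ?; split; lia.
(* Here [w] is on the arc from [c] to [a], opposite [b]: a shortest route from [w] to [b] passes
   through [a] or through [c]. The other arcs are analogous. *)
have [aw|wa] := leqP a w; last first.
  have [h|/ltnW h] := leqP (b - w).*2 n.
    by rewrite (@cycle_betweenC n b a) (@cycle_between_direct n w a b) ?orbT //; lia.
  by rewrite (@cycle_between_wrapr n w b c) ?orbT //; lia.
have [bw|wb] := leqP b w; last first.
  have [h|/ltnW h] := leqP (c - w).*2 n.
    by rewrite (@cycle_betweenC n c b) (@cycle_between_direct n w b c) ?orbT //; lia.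
  by rewrite (@cycle_between_wrapl n a w c) ?orbT //; lia.
have [cw|wc] := leqP c w; last first.
  have [h|/ltnW h] := leqP (w - a).*2 n.
    by rewrite cycle_between_direct //; lia.
  by rewrite (@cycle_betweenC n a c) (@cycle_between_wrapr n a w c) ?orbT //; lia.
have [h|/ltnW h] := leqP (w - b).*2 n.
  by rewrite (@cycle_between_direct n b c w) ?orbT //; lia.
by rewrite (@cycle_betweenC n b a) (@cycle_between_wrapl n a b w) ?orbT //; lia.
Qed.

Lemma cycle_between_cover n a b c w :
  a < n -> b < n -> c < n -> w < n -> a != b -> a != c -> b != c ->
  ~~ cycle_between n a b c -> ~~ cycle_between n b a c ->
  ~~ cycle_between n a c b ->
  [|| cycle_between n a b w, cycle_between n a c w, cycle_between n b a w,
      cycle_between n b c w, cycle_between n c a w | cycle_between n c b w].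
Proof.
move=> an bn cn wn ab ac bc.
have C x y z (h : x < y < z) (hz : z < n) :=
  @cycle_between_cover_sorted n x y z w h hz wn.
move: {C} (C a b c) (C a c b) (C b a c) (C b c a) (C c a b) (C c b a).
rewrite (@cycle_betweenC n c b a) (@cycle_betweenC n c a b).
by rewrite (@cycle_betweenC n b c a); lia.
Qed.

Definition prism_dist n (x y : 'I_n * 'I_2) : nat :=
  cycle_dist n x.1 y.1 + (x.2 != y.2).

Lemma cycle_graphE n (i j : 'I_n) :
  cycle_graph i j =
  [|| i.+1 == j, j.+1 == i, (i.+1 == n) && (j == 0 :> nat)
    | (j.+1 == n) && (i == 0 :> nat)].
Proof.
have ordSE (a b : 'I_n) :
    (b == ordS a) = (a.+1 == b) || (a.+1 == n) && (b == 0 :> nat).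
  rewrite -val_eqE /=; have := ltn_ord a; have := ltn_ord b.
  rewrite [a < n]leq_eqVlt => bn /predU1P[an|an].
    by rewrite an modnn eqxx /=; lia.
  by rewrite modn_small //; lia.
rewrite /cycle_graph !ordSE; lia.
Qed.

Section PrismDistance.

Variable n : nat.
Implicit Types x y z : 'I_n * 'I_2.

Lemma prism_distxx x : prism_dist x x = 0.
Proof. by rewrite /prism_dist eqxx /cycle_dist; lia. Qed.

Lemma prism_distC x y : prism_dist x y = prism_dist y x.
Proof. by rewrite /prism_dist /cycle_dist [x.2 == _]eq_sym; lia. Qed.

Lemma prism_dist_eq0 x y : prism_dist x y = 0 -> x = y.
Proof.
case: x y => [i a] [j b]; rewrite /prism_dist /cycle_dist /=.
case: eqP => [->|] /= dij; last by lia.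
congr (_, _); apply: val_inj => /=; have := ltn_ord i; have := ltn_ord j; lia.
Qed.

Lemma prism_dist_lipschitz x y z :
  prism x y -> prism_dist x z <= (prism_dist y z).+1.
Proof.
case: x y z => [i a] [j b] [k c].
rewrite /prism /cartesian_product /complete_graph cycle_graphE.
rewrite /prism_dist /cycle_dist /=.
move: (ltn_ord i) (ltn_ord j) (ltn_ord k) => ? ? ? /orP[/andP[/eqP-> _]|/andP[+ /eqP->]]; last by lia.
by do 2!case: (_ != c); lia.
Qed.

Lemma prism_dist_descent x y k :
  prism_dist x y = k.+1 -> exists2 z, prism x z & prism_dist z y = k.
Proof.
case: x y => [i a] [j b]; rewrite /prism_dist /=.
have [<-|ab] := eqVneq a b; last first.
  move=> dk; exists (i, b); last by rewrite /= eqxx; lia.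
  by rewrite /prism /cartesian_product /complete_graph /= eqxx ab.
rewrite addn0 => dk.
have [m [mn dm im]] := cycle_dist_descent (ltn_ord i) (ltn_ord j) dk.
exists (Ordinal mn, a); last by rewrite /= eqxx addn0.
by rewrite /prism /cartesian_product /= cycle_graphE im eqxx orbT.
Qed.

Lemma prism_general_positionP (S : {set 'I_n * 'I_2}) :
  general_position (@prism n) S <->
  (forall u v w, u \in S -> v \in S -> w \in S -> uniq [:: u; v; w] ->
    prism_dist u v + prism_dist v w != prism_dist u w).
Proof.
exact: (general_positionP prism_distxx prism_dist_lipschitz prism_dist_eq0
          prism_dist_descent).
Qed.

End PrismDistance.

(** * Upper bounds *)

Section UpperBounds.

Variable n : nat.
Variable S : {set 'I_n * 'I_2}.
Hypothesis gpS : general_position (@prism n) S.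

(** With [u] and [v] in one layer, [w] differs in layer from both or from neither, so betweenness of
    the columns alone makes the triangle inequality tight. *)
Lemma same_layer_not_between u v w :
  u \in S -> v \in S -> w \in S -> u != v -> u != w -> v != w ->
  u.2 = v.2 -> ~~ cycle_between n u.1 v.1 w.1.
Proof.
move=> uS vS wS uv uw vw uv2; apply/negP => /eqP bw.
have /prism_general_positionP/(_ u v w uS vS wS) := gpS.
rewrite /= !inE negb_or uv uw vw => /(_ isT) /eqP; apply.
by rewrite /prism_dist uv2 eqxx addn0 addnA bw.
Qed.

Lemma card_general_position_le4 : #|S| <= 4.
Proof.
pose A l := [set x in S | x.2 == l].
have SA : S = A ord0 :|: A ord_max.
  apply/setP=> -[i [[|[|//]] hl]]; rewrite !inE -!val_eqE /= ?andbT ?andbF //.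
  by rewrite orbF.
rewrite leqNgt; apply/negP => S_gt4.
have [l] : exists l, 2 < #|A l|.
  have := leq_trans S_gt4 (eq_leq (congr1 (fun B => #|pred_of_set B|) SA)).
  rewrite cardsU; have [?|] := ltnP 2 #|A ord0|; first by exists ord0.
  have [?|] := ltnP 2 #|A ord_max|; first by exists ord_max.
  by lia.
case/card_gt2P=> a [b [c [[]]]]; rewrite !inE.
move=> /andP[aS /eqP a2] /andP[bS /eqP b2] /andP[cS /eqP c2] [ab bc].
rewrite eq_sym => ac.
have [w wS] : exists2 w, w \in S & w \notin [set a; b; c].
  apply/subsetPn; apply: contraTN S_gt4 => /subset_leq_card sub.
  rewrite -leqNgt (leq_trans sub) // -setUA cardsU1 cardsU1 cards1.
  by do 2!case: (_ \notin _).
rewrite !inE !negb_or -andbA => /and3P[wa wb wc].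
(* The layer of [x] is free, so this serves both for the hypotheses of [cycle_between_cover] and,
   with [x] equal to [w], against each of its alternatives. *)
have nb u v x : u \in S -> v \in S -> x \in S -> u != v -> x != u -> x != v ->
    u.2 = l -> v.2 = l -> ~~ cycle_between n u.1 v.1 x.1.
  move=> uS vS xS uv xu xv u2 v2.
  by apply: same_layer_not_between; rewrite // 1?eq_sym // u2 v2.
have ne (u v : 'I_n * 'I_2) : u != v -> u.2 = l -> v.2 = l -> (u.1 : nat) != v.1.
  move=> uv u2 v2; apply/eqP=> /ord_inj uv1; case/eqP: uv.
  by rewrite [u]surjective_pairing [v]surjective_pairing uv1 u2 v2.
have := @cycle_between_cover n a.1 b.1 c.1 w.1 (ltn_ord _) (ltn_ord _)
  (ltn_ord _) (ltn_ord _) (ne _ _ ab a2 b2) (ne _ _ ac a2 c2) (ne _ _ bc b2 c2).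
have ba : b != a by rewrite eq_sym.
have ca : c != a by rewrite eq_sym.
have cb : c != b by rewrite eq_sym.
rewrite !nb // => /(_ isT isT isT).
by do 6!rewrite (negPf (nb _ _ w _ _ _ _ _ _ _ _)) //.
Qed.

(** A third vertex shares the layer of [x] or of [y], and that one then lies between it and the
    other. *)
Lemma general_position_column x y :
  2 < #|S| -> x \in S -> y \in S -> x.1 = y.1 -> x = y.
Proof.
move=> S_gt2 xS yS xy1; apply/eqP; apply: contraLR S_gt2 => xy.
have xy2 : x.2 != y.2.
  apply: contraNneq xy => xy2.
  by rewrite [x]surjective_pairing [y]surjective_pairing xy1 xy2.
rewrite -leqNgt; suff /subset_leq_card : S \subset [set x; y].
  by rewrite cards2 xy.
apply/subsetP=> z zS; rewrite !inE; apply: contraT; rewrite negb_or.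
move=> /andP[zx zy].
have [zx2|zx2] := eqVneq z.2 x.2.
  have := same_layer_not_between zS xS yS zx zy xy zx2.
  by rewrite /cycle_between -xy1 /cycle_dist !subnn min0n addn0 eqxx.
have zy2 : z.2 = y.2.
  apply/eqP; move: zx2 xy2; rewrite -!val_eqE /=.
  have := ltn_ord x.2; have := ltn_ord y.2; have := ltn_ord z.2.
  by move: (nat_of_ord x.2) (nat_of_ord y.2) (nat_of_ord z.2) => i j k; lia.
have yx : y != x by rewrite eq_sym.
have := same_layer_not_between zS yS xS zy zx yx zy2.
by rewrite /cycle_between xy1 /cycle_dist !subnn min0n addn0 eqxx.
Qed.

Lemma card_general_position_columns : 2 < #|S| -> #|S| <= n.
Proof.
move=> S_gt2; rewrite -[leqRHS]card_ord -(card_in_imset (f := fst)).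
  exact: max_card.
by move=> x y xS yS; apply: general_position_column.
Qed.

End UpperBounds.

(** * The case of the 3-cube *)

(** Every vertex of the cube lies between two antipodes, and its distances to the ends of an edge
    differ by one; this excludes distances 3 and 1. The proof enumerates all triples. *)
Lemma prism4_triple (x y z : 'I_4 * 'I_2) :
  uniq [:: x; y; z] ->
  prism_dist x y + prism_dist y z != prism_dist x z ->
  prism_dist y x + prism_dist x z != prism_dist y z ->
  prism_dist x z + prism_dist z y != prism_dist x y -> prism_dist x y = 2.
Proof.
case: x => [[[|[|[|[|//]]]] ?] [[|[|//]] ?]];
case: y => [[[|[|[|[|//]]]] ?] [[|[|//]] ?]];
case: z => [[[|[|[|[|//]]]] ?] [[|[|//]] ?]]; by [].
Qed.

(** An edge changes the parity of the distance to [z]. *)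
Lemma prism4_bipartite (x y z : 'I_4 * 'I_2) :
  prism x y -> prism_dist x z = 2 -> prism_dist y z <> 2.
Proof.
case: x => [[[|[|[|[|//]]]] ?] [[|[|//]] ?]];
case: y => [[[|[|[|[|//]]]] ?] [[|[|//]] ?]];
case: z => [[[|[|[|[|//]]]] ?] [[|[|//]] ?]]; by [].
Qed.

(** Two robots [x], [y] stay put, so general position before and after the move puts the adjacent
    vertices [u] and [v] both at distance 2 from [x]. *)
Lemma prism4_no_move (S S' : {set 'I_4 * 'I_2}) :
  general_position (@prism 4) S -> 2 < #|S| -> ~ legal_move (@prism 4) S S'.
Proof.
move=> gpS S_gt2 [u [v [uS uv vS -> gpS']]].
have dist2 (A : {set 'I_4 * 'I_2}) x y z : general_position (@prism 4) A ->
    x \in A -> y \in A -> z \in A -> x != y -> x != z -> y != z ->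
    prism_dist x y = 2.
  move=> /prism_general_positionP gpA xA yA zA xy xz yz.
  apply: (@prism4_triple x y z); rewrite ?gpA //= !inE ?negb_or;
    by rewrite ?[y == x]eq_sym ?[z == y]eq_sym ?xy ?xz ?yz.
have /card_gt1P[x [y []]] : 1 < #|S :\ u| by move: S_gt2; rewrite (cardsD1 u) uS.
rewrite !inE => /andP[xu xS] /andP[yu yS] xy.
have vx : v != x by apply: contraNneq vS => ->.
have vy : v != y by apply: contraNneq vS => ->.
apply: (prism4_bipartite uv (z := x)).
  by apply: (dist2 S _ _ y); rewrite // 1?eq_sym.
apply: (dist2 _ _ _ y gpS'); rewrite // !inE ?eqxx //.
  by rewrite xu xS orbT.
by rewrite yu yS orbT.
Qed.

Lemma prism4_mobile_card (S : {set 'I_4 * 'I_2}) :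
  mobile (@prism 4) S -> #|S| <= 2.
Proof.
case=> gpS [s [sp cov]]; rewrite leqNgt; apply/negP => S_gt2.
(* Without a legal first move the schedule is empty, and [S] would have to be all 8 vertices. *)
case: s sp cov => [_ cov|S' s /= /andP[/asboolP mv _] _]; last first.
  exact: prism4_no_move mv.
have ST : S = setT.
  by apply/setP=> v; rewrite inE; have [A] := cov v; rewrite inE => /eqP->.
have := card_general_position_le4 gpS.
by rewrite ST cardsT card_prod !card_ord.
Qed.

(** * Legal moves and schedules *)

Section Moves.

Variables (T : finType) (e : rel T).
Hypothesis e_irr : irreflexive e.

Lemma legal_move_swap (A : {set T}) u v :
  e u v -> u \notin A -> v \notin A -> general_position e (v |: A) ->
  legal_move e (u |: A) (v |: A).
Proof.
move=> euv uA vA gpvA; exists u, v; split=> //; first exact: setU11.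
  rewrite !inE negb_or vA andbT.
  by apply: contraTneq euv => ->; rewrite e_irr.
by rewrite setU1K.
Qed.

(** Passing from [S t] to [S t.+1] may take several legal moves, so a periodic motion needs only one
    configuration per period. *)
Lemma mobile_of_schedule (S : nat -> {set T}) m :
  general_position e (S 0) ->
  (forall t, exists s, path (fun A B => `[< legal_move e A B >]) (S t) s /\
    last (S t) s = S t.+1) ->
  (forall v, exists2 t, t <= m & v \in S t) ->
  mobile e (S 0).
Proof.
move=> gp0 step cov; split=> //.
have [s [sp _ sin]] : exists s,
    [/\ path (fun A B => `[< legal_move e A B >]) (S 0) s, last (S 0) s = S m
      & forall t, t <= m -> S t \in S 0 :: s].
  elim: (m) => [|k [s [sp sl sin]]].
    by exists [::]; split=> // -[|//] _; apply: mem_head.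
  have [r [rp rl]] := step k; exists (s ++ r); split.
  - by rewrite cat_path sp sl.
  - by rewrite last_cat sl.
  move=> t; rewrite leq_eqVlt ltnS -cat_cons mem_cat => /predU1P[->|/sin-> //].
  have := mem_last (S k) r; rewrite rl inE => /predU1P[->|->].
    by rewrite sin.
  by rewrite orbT.
exists s; split=> // v; have [t tm vS] := cov v.
by exists (S t) => //; apply: sin.
Qed.

Lemma general_position_small (S : {set T}) :
  #|S| <= 2 -> general_position e S.
Proof.
move=> S_le2 x p u v w _ uS vS wS /= /andP[uvw /andP[vw _]] _.
have : 2 < #|S|.
  apply/card_gt2P; exists u, v, w; split=> //.
  by move: uvw vw; rewrite !inE negb_or => /andP[? ?] ?; rewrite [w == u]eq_sym.
by rewrite ltnNge S_le2.
Qed.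

End Moves.

Lemma mob_ge (T : finType) (e : rel T) (S : {set T}) :
  mobile e S -> #|S| <= mob e.
Proof.
move=> mS; rewrite /mob.
by apply: (@leq_bigmax_cond _ _ (fun A : {set T} => #|A|)); apply/asboolP.
Qed.

Lemma mob_le (T : finType) (e : rel T) m :
  (forall S, mobile e S -> #|S| <= m) -> mob e <= m.
Proof. by move=> h; apply/bigmax_leqP=> S /asboolP; apply: h. Qed.

Lemma ord2P (l : 'I_2) : l = ord0 \/ l = ord_max.
Proof. by case: l => [[|[|//]] hl]; [left|right]; apply: val_inj. Qed.

(** * Lower bounds by robots advancing around the cycle *)

Section LowerBounds.

Variable n : nat.
Hypothesis n_gt2 : 2 < n.

Let n_gt0 : 0 < n. Proof. exact: ltn_trans n_gt2. Qed.

(** Positions are unbounded naturals read modulo [n], so the order and gaps of circulating robots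
    remain linear inequalities. *)
Definition cycle_pt (p : nat) : 'I_n := Ordinal (ltn_pmod p n_gt0).

Lemma cycle_pt_id (i : 'I_n) : cycle_pt i = i.
Proof. by apply: val_inj; rewrite /= modn_small. Qed.

Lemma prism_irr : irreflexive (@prism n).
Proof.
apply: cartesian_product_irr; first exact: cycle_graph_irr.
exact: complete_graph_irr.
Qed.

Lemma prism_step p l : prism (cycle_pt p, l) (cycle_pt p.+1, l).
Proof.
rewrite /prism /cartesian_product /cycle_graph /= eqxx andbT.
by rewrite -!val_eqE /= -[(p %% n).+1]addn1 modnDml addn1 eqxx orbT.
Qed.

Lemma cycle_dist_mod p q : p <= q < p + n ->
  cycle_dist n (cycle_pt p) (cycle_pt q) =
  if (q - p).*2 <= n then q - p else n - (q - p).
Proof.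
move=> /andP[pq qpn] /=; rewrite -{1}(subnKC pq) -modnDml.
have := ltn_pmod p n_gt0; move: (p %% n) => r rn.
have [lt|ge] := ltnP (r + (q - p)) n.
  by rewrite modn_small // cycle_distE; [rewrite addKn|lia].
rewrite -(subnK ge) modnDr modn_small; last by lia.
by rewrite cycle_distC cycle_distE; [do !case: ifP; lia|lia].
Qed.

Lemma cycle_pt_neq p q : p < q < p + n -> (cycle_pt p == cycle_pt q) = false.
Proof.
move=> /andP[pq qpn]; apply/negP => /eqP ptpq.
have := @cycle_dist_mod p q; rewrite ptpq (ltnW pq) qpn => /(_ isT).
by rewrite {1}/cycle_dist subnn; case: ifP; lia.
Qed.

Lemma general_position4 (x1 x2 x3 x4 : 'I_n * 'I_2) (D := @prism_dist n) :
  (forall u v w, (u, v, w) \in [:: (x1, x2, x3); (x1, x2, x4); (x1, x3, x4);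
                                   (x2, x3, x4)] ->
    [/\ D u v + D v w <> D u w, D u v + D u w <> D v w
      & D u w + D v w <> D u v]) ->
  general_position (@prism n) [set x1; x2; x3; x4].
Proof.
rewrite /D => nc.
have [a1 a2 a3] := nc x1 x2 x3 ltac:(by rewrite !inE eqxx ?orbT).
have [b1 b2 b3] := nc x1 x2 x4 ltac:(by rewrite !inE eqxx ?orbT).
have [c1 c2 c3] := nc x1 x3 x4 ltac:(by rewrite !inE eqxx ?orbT).
have [d1 d2 d3] := nc x2 x3 x4 ltac:(by rewrite !inE eqxx ?orbT).
apply/prism_general_positionP => u v w.
rewrite !inE -!orbA => /or4P[]/eqP-> /or4P[]/eqP-> /or4P[]/eqP->;
  rewrite /= ?inE ?eqxx ?orbT ?andbF // => _;
  rewrite ?(prism_distC x2 x1) ?(prism_distC x3 x1) ?(prism_distC x4 x1)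
    ?(prism_distC x3 x2) ?(prism_distC x4 x2) ?(prism_distC x4 x3);
  apply/eqP; try (by []); by rewrite addnC.
Qed.

Definition interleaved p1 p2 p3 p4 : {set 'I_n * 'I_2} :=
  [set (cycle_pt p1, ord0); (cycle_pt p2, ord_max);
       (cycle_pt p3, ord0); (cycle_pt p4, ord_max)].

(** The positions lie within one turn; [p1 + n - p4] is the gap that closes it. *)
Definition short_gaps p1 p2 p3 p4 :=
  [&& p1 < p2 < p3, p3 < p4 < p1 + n, (p2 - p1).*2 < n, (p3 - p2).*2 < n,
      (p4 - p3).*2 < n & (p1 + n - p4).*2 < n].

(** In any triple two robots share a layer. The two layer changes keep the third from lying between
    them; if one of the two lay between the others, some gap would be 0 or exactly n/2. *)
Lemma interleaved_general_position p1 p2 p3 p4 : short_gaps p1 p2 p3 p4 ->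
  general_position (@prism n) (interleaved p1 p2 p3 p4).
Proof.
case/and5P=> /andP[h12 h23] /andP[h34 h41] g1 g2 /andP[g3 g4].
have d12 : prism_dist (cycle_pt p1, ord0) (cycle_pt p2, ord_max) = (p2 - p1).+1.
  by rewrite /prism_dist cycle_dist_mod /= ?addn1; [case: ifP|]; lia.
have d23 : prism_dist (cycle_pt p2, ord_max) (cycle_pt p3, ord0) = (p3 - p2).+1.
  by rewrite /prism_dist cycle_dist_mod /= ?addn1; [case: ifP|]; lia.
have d34 : prism_dist (cycle_pt p3, ord0) (cycle_pt p4, ord_max) = (p4 - p3).+1.
  by rewrite /prism_dist cycle_dist_mod /= ?addn1; [case: ifP|]; lia.
have d14 : prism_dist (cycle_pt p1, ord0) (cycle_pt p4, ord_max)
    = (p1 + n - p4).+1.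
  by rewrite /prism_dist cycle_dist_mod /= ?addn1; [case: ifP|]; lia.
have d13 : prism_dist (cycle_pt p1, ord0) (cycle_pt p3, ord0) =
    if (p3 - p1).*2 <= n then p3 - p1 else n - (p3 - p1).
  by rewrite /prism_dist cycle_dist_mod /= ?addn0 //; lia.
have d24 : prism_dist (cycle_pt p2, ord_max) (cycle_pt p4, ord_max) =
    if (p4 - p2).*2 <= n then p4 - p2 else n - (p4 - p2).
  by rewrite /prism_dist cycle_dist_mod /= ?addn0 //; lia.
apply: general_position4 => u v w.
rewrite !inE => /or4P[]/eqP[-> -> ->]; rewrite ?d12 ?d23 ?d34 ?d14 ?d13 ?d24;
  case: ifP => ?; split; lia.
Qed.

Lemma interleaved_card p1 p2 p3 p4 :
  short_gaps p1 p2 p3 p4 -> #|interleaved p1 p2 p3 p4| = 4.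
Proof.
case/and5P=> /andP[h12 h23] /andP[h34 h41] _ _ _.
rewrite /interleaved -!setUA !cardsU1 cards1 !inE !xpair_eqE /=.
by rewrite !andbT !andbF !cycle_pt_neq //; lia.
Qed.

Lemma interleaved_move p1 p2 p3 p4 q1 q2 q3 q4 :
  short_gaps p1 p2 p3 p4 -> short_gaps q1 q2 q3 q4 ->
  [\/ [/\ q1 = p1.+1, q2 = p2, q3 = p3 & q4 = p4],
      [/\ q1 = p1, q2 = p2.+1, q3 = p3 & q4 = p4],
      [/\ q1 = p1, q2 = p2, q3 = p3.+1 & q4 = p4]
    | [/\ q1 = p1, q2 = p2, q3 = p3 & q4 = p4.+1]] ->
  `[< legal_move (@prism n) (interleaved p1 p2 p3 p4)
                            (interleaved q1 q2 q3 q4) >].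
Proof.
move=> gp gq h; apply/asboolP.
have := interleaved_general_position gq.
move: gp gq => /and5P[/andP[a1 a2] /andP[a3 a4] _ _ _].
move=> /and5P[/andP[b1 b2] /andP[b3 b4] _ _ _].
rewrite /interleaved.
(* Each case brings the moving robot to the front of the union for [legal_move_swap]; the strict
   inequalities before and after keep the other robot of its layer off both ends of the edge. *)
case: h b1 b2 b3 b4 => -[-> -> -> ->] b1 b2 b3 b4.
- rewrite -!setUA; apply: legal_move_swap; first exact: prism_irr.
  + exact: prism_step.
  + by rewrite !inE !xpair_eqE /= !andbF orbF andbT cycle_pt_neq //; lia.
  + by rewrite !inE !xpair_eqE /= !andbF orbF andbT cycle_pt_neq //; lia.
- rewrite -!setUA ![(_, ord0) |: ((_, ord_max) |: _)]setUCA.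
  apply: legal_move_swap; first exact: prism_irr.
  + exact: prism_step.
  + by rewrite !inE !xpair_eqE /= !andbF andbT cycle_pt_neq //; lia.
  + by rewrite !inE !xpair_eqE /= !andbF andbT cycle_pt_neq //; lia.
- rewrite -!(setUAC _ [set (cycle_pt p4, _)]) ![_ :|: [set (_, ord0)]]setUC.
  apply: legal_move_swap; first exact: prism_irr.
  + exact: prism_step.
  + by rewrite !inE !xpair_eqE /= !andbF andbT eq_sym cycle_pt_neq //; lia.
  + by rewrite !inE !xpair_eqE /= !andbF andbT eq_sym cycle_pt_neq //; lia.
rewrite ![_ :|: [set (_, ord_max)]]setUC.
apply: legal_move_swap; first exact: prism_irr.
+ exact: prism_step.
+ by rewrite !inE !xpair_eqE /= !andbF andbT eq_sym cycle_pt_neq //; lia.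
+ by rewrite !inE !xpair_eqE /= !andbF andbT eq_sym cycle_pt_neq //; lia.
Qed.

Lemma interleaved_mobile (g : nat) :
  (forall t, exists s,
    path (fun A B => `[< legal_move (@prism n) A B >])
      (interleaved t t.+1 t.+2 (t.+2 + g)) s /\
    last (interleaved t t.+1 t.+2 (t.+2 + g)) s =
      interleaved t.+1 t.+2 t.+3 (t.+3 + g)) ->
  short_gaps 0 1 2 (2 + g) -> 4 <= mob (@prism n).
Proof.
move=> step sg; rewrite -(interleaved_card sg); apply: mob_ge.
apply: (@mobile_of_schedule _ _
  (fun t => interleaved t t.+1 t.+2 (t.+2 + g)) n.*2) => //.
  exact: interleaved_general_position.
(* The first robot is at [i] at time [i]. The second runs one position ahead, so it is at [i + n] at
   time [i + n - 1], which also covers [i = 0]. *)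
case=> i l; rewrite -(cycle_pt_id i); case: (ord2P l) => ->.
  by exists i; [have := ltn_ord i; lia|rewrite !inE eqxx].
exists (i + n.-1); first by have := ltn_ord i; lia.
have -> : cycle_pt i = cycle_pt (i + n.-1).+1.
  by apply: val_inj; rewrite /= -addnS prednK // modnDr.
by rewrite !inE eqxx orbT.
Qed.

Lemma prism_mob_ge4 : 4 < n -> 4 <= mob (@prism n).
Proof.
rewrite leq_eqVlt => /predU1P[n5|n_gt5].
  (* Gaps are at most 2 here, so one is 2 and the others are 1. The robot behind the gap of 2
     advances: fourth, third, second, first. *)
  apply: (@interleaved_mobile 1) => [t|]; last by rewrite /short_gaps -n5.
  exists [:: interleaved t t.+1 t.+2 t.+4; interleaved t t.+1 t.+3 t.+4;
             interleaved t t.+2 t.+3 t.+4; interleaved t.+1 t.+2 t.+3 t.+4].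
  rewrite /= !addn1; split=> //; apply/and5P; split=> //;
    apply: interleaved_move; rewrite /short_gaps -?n5; try lia;
    by [constructor 1|constructor 2|constructor 3|constructor 4].
(* The largest gap shorter than n/2. It is at least 2 here, which lets the third robot move first;
   for n = 5 the fourth would run into the first in this order. *)
pose g := n.-1./2.
apply: (@interleaved_mobile g) => [t|]; last by rewrite /short_gaps /g; lia.
exists [:: interleaved t t.+1 t.+3 (t.+2 + g);
           interleaved t t.+2 t.+3 (t.+2 + g);
           interleaved t t.+2 t.+3 (t.+3 + g);
           interleaved t.+1 t.+2 t.+3 (t.+3 + g)].
split=> //=; apply/and5P; split=> //;
  apply: interleaved_move; rewrite /short_gaps /g; try lia;
  by [constructor 1|constructor 2|constructor 3|constructor 4].
Qed.

Definition column_pair p q : {set 'I_n * 'I_2} :=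
  [set (cycle_pt p, ord0); (cycle_pt q, ord_max)].

Lemma column_pair_card p q : #|column_pair p q| = 2.
Proof. by rewrite cards2 xpair_eqE andbF. Qed.

(** Two robots are always in general position, and on different layers neither blocks the other's
    way round. *)
Lemma prism_mob_ge2 : 2 <= mob (@prism n).
Proof.
have gp p q : general_position (@prism n) (column_pair p q).
  by apply: general_position_small; rewrite column_pair_card.
rewrite -[leqLHS](column_pair_card 0 0); apply: mob_ge.
apply: (@mobile_of_schedule _ _ (fun t => column_pair t t) n) => // [t|].
  exists [:: column_pair t.+1 t; column_pair t.+1 t.+1]; split=> //=.
  apply/and3P; split=> //; apply/asboolP.
    apply: legal_move_swap; [exact: prism_irr|exact: prism_step| | |exact: gp].
      by rewrite inE xpair_eqE andbF.
    by rewrite inE xpair_eqE andbF.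
  have := gp t.+1 t.+1; rewrite /column_pair ![[set (_, ord0)] :|: _]setUC.
  apply: legal_move_swap; [exact: prism_irr|exact: prism_step| |].
    by rewrite inE xpair_eqE andbF.
  by rewrite inE xpair_eqE andbF.
case=> i l; rewrite -(cycle_pt_id i); exists i; first exact: ltnW.
by case: (ord2P l) => ->; rewrite !inE eqxx ?orbT.
Qed.

End LowerBounds.

(** * Three robots on the prism over the triangle *)

Definition prism3_section t : {set 'I_3 * 'I_2} :=
  [set x : 'I_3 * 'I_2 | x.2 == (if x.1 < t then ord_max else ord0)].

Lemma prism3_section_inj t : {in prism3_section t &, injective fst}.
Proof.
move=> [i a] [j b]; rewrite !inE /= => /eqP-> /eqP-> ->.
by [].
Qed.

(** Distinct columns are at distance 1, so a tight inequality would need [v] in the layer of both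
    [u] and [w] while these two differ in layer. *)
Lemma prism3_section_general_position t :
  general_position (@prism 3) (prism3_section t).
Proof.
apply/prism_general_positionP => u v w uS vS wS.
rewrite /= !inE negb_or andbT => /andP[/andP[uv uw] vw].
have d x y : x \in prism3_section t -> y \in prism3_section t -> x != y ->
    prism_dist x y = (x.2 != y.2).+1.
  move=> xS yS xy; suff d1 : cycle_dist 3 x.1 y.1 = 1 by rewrite /prism_dist d1.
  have : x.1 != y.1 by apply: contraNneq xy => /(prism3_section_inj xS yS)->.
  move: (x.1) (y.1) => i j.
  by case: i => [[|[|[|//]]] ?]; case: j => [[|[|[|//]]] ?].
rewrite !d //; have [->|_] := eqVneq u.2 v.2; first by case: (v.2 != w.2).
by case: (v.2 != w.2); case: (u.2 != w.2).
Qed.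

Lemma prism3_section_card t : #|prism3_section t| = 3.
Proof.
rewrite -(card_in_imset (@prism3_section_inj t)) -[RHS]card_ord -cardsT.
congr #|pred_of_set _|; apply/setP=> i; rewrite inE; apply/imsetP.
by exists (i, if i < t then ord_max else ord0); rewrite ?inE /=.
Qed.

Lemma prism3_section_move t : t < 3 ->
  legal_move (@prism 3) (prism3_section t) (prism3_section t.+1).
Proof.
move=> t3; pose i := Ordinal t3.
exists (i, ord0), (i, ord_max); split.
- by rewrite inE /= ltnn.
- by rewrite /prism /cartesian_product /complete_graph /= eqxx.
- by rewrite inE /= ltnn.
- apply/setP=> -[j l]; rewrite !inE !xpair_eqE /= -!val_eqE /=.
  by case: l => [[|[|//]] ?] /=; do !case: ifP => /=; lia.
exact: prism3_section_general_position.
Qed.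

Lemma prism3_mob_ge3 : 3 <= mob (@prism 3).
Proof.
rewrite -[leqLHS](prism3_section_card 0); apply: mob_ge.
apply: (@mobile_of_schedule _ _ prism3_section 3) => [|t|].
- exact: prism3_section_general_position.
- have [t3|t3] := ltnP t 3.
    exists [:: prism3_section t.+1]; split=> //=; rewrite andbT; apply/asboolP.
    exact: prism3_section_move.
  (* From time 3 on all robots are in the upper layer and nothing moves. *)
  exists [::]; split=> //=; apply/setP=> -[j l]; rewrite !inE /=.
  by rewrite ltnS (leq_trans (ltn_ord j) t3) (leq_trans (ltnW (ltn_ord j)) t3).
case=> i l; case: (ord2P l) => ->; first by exists 0; rewrite // inE.
by exists 3; rewrite // inE /= ltn_ord.
Qed.

Theorem theorem3p4 (n : nat) (hn : 3 <= n) :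
  mob (cartesian_product (@cycle_graph n) (@complete_graph 2)) =
  (if n == 3 then 3 else if n == 4 then 2 else 4).
Proof.
have le4 S : mobile (@prism n) S -> #|S| <= 4.
  by case=> gpS _; apply: card_general_position_le4.
apply/eqP; rewrite -/(@prism n) eqn_leq.
have [n3|n3] := eqVneq n 3.
  subst n; rewrite prism3_mob_ge3 andbT; apply: mob_le => S [gpS _].
  rewrite leqNgt; apply/negP => S_gt3.
  by have := card_general_position_columns gpS (ltnW S_gt3); rewrite leqNgt S_gt3.
have [n4|n4] := eqVneq n 4.
  subst n; rewrite prism_mob_ge2 // andbT.
  by apply: mob_le => S; apply: prism4_mobile_card.
rewrite mob_le //= prism_mob_ge4 //; lia.
Qed.
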